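(* Let $Y \subseteq \mathbb{A}^n$ be a linear subspace (through the origin, defined over $K$). Then the continuous surjection $\mathrm{trop}_Y : Y^{\mathrm{an}} \to \mathrm{Trop}(Y)$, $w \mapsto (w(x_1|_Y),\ldots,w(x_n|_Y))$, has a continuous section, i.e. there is a continuous map $\sigma:\mathrm{Trop}(Y) \to Y^{\mathrm{an}}$ with $\mathrm{trop}_Y\circ\sigma=\mathrm{id}$.
   Context: $\mathbb{R}_\infty := \mathbb{R}\cup\{\infty\}$ carries the topology of a half-open interval. $K$ is a field with a non-Archimedean valuation $v: K \to \mathbb{R}_\infty$, assumed surjective. $\mathbb{A}^n$ is affine $n$-space over $K$ with coordinates $x_1,\ldots,x_n$. For an affine variety $X$ over $K$ with coordinate ring $K[X]$, the analytification $X^{\mathrm{an}}$ is the set of all ring valuations $w: K[X] \to \mathbb{R}_\infty$ extending $v$ (so $w(fg)=w(f)+w(g)$, $w(f+g)\ge\min(w(f),w(g))$, $w|_K=v$), with the topology of pointwise convergence. For a closed subvariety $X\subseteq\mathbb{A}^n$, $\mathrm{Trop}(X)\subseteq\mathbb{R}_\infty^n$ is the image of the continuous map $\mathrm{trop}:X^{\mathrm{an}}\to\mathbb{R}_\infty^n$, $w\mapsto(w(x_1),\ldots,w(x_n))$, with the subspace topology. *)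

(* Defs.v *)
From HB Require Import structures.
From mathcomp Require Import all_boot all_order all_algebra.
From mathcomp Require Import generic_quotient ring_quotient.
From mathcomp Require Import boolp classical_sets functions reals.
From mathcomp Require Import constructive_ereal ereal topology.
From mathcomp Require Import (canonicals) mpoly.

Set Implicit Arguments.
Unset Strict Implicit.
Unset Printing Implicit Defensive.

Import Order.TTheory GRing.Theory Num.Theory.

Local Open Scope classical_set_scope.
Local Open Scope ring_scope.

(* As a type this is the library's [set_type], i.e. the half-open interval
   ]-oo, +oo] with the topology induced from the extended real line; it is
   stable under the addition of [\bar R]. *)
Definition Rinf (R : realType) : set (\bar R) := [set x | x != -oo%E].
Arguments Rinf : clear implicits.

Definition is_valuation (R : realType) (A : comNzRingType) (w : A -> Rinf R) :=
  (forall f g, val (w (f * g)) = (val (w f) + val (w g))%E) /\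
  (forall f g, (Order.min (val (w f)) (val (w g)) <= val (w (f + g)%R))%E).

Definition is_field_valuation (R : realType) (K : fieldType) (v : K -> Rinf R) :=
  is_valuation v /\ (forall a, val (v a) = +oo%E <-> a = 0).

(* Here [iota] is the structure morphism of the K-algebra A. *)
Definition analytification (R : realType) (K : fieldType) (v : K -> Rinf R)
    (A : comNzRingType) (iota : K -> A) : set {ptws A -> Rinf R} :=
  [set w : A -> Rinf R | is_valuation w /\ forall c, w (iota c) = v c].

Lemma continuous_ptws (X V : topologicalType) (U : Type)
    (f : X -> {ptws U -> V}) :
  (forall u, continuous (fun x => f x u)) -> continuous f.
Proof.
move=> h x; apply/cvg_sup => u.
exact: (@continuous_comp_initial _ X V (fun g : U -> V => g u) f (h u) x).
Qed.

Section LinearSubspace.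
Variables (K : fieldType) (n : nat) (Y : {vspace 'rV[K]_n}).

(* If K is infinite (e.g. if it carries a nontrivial valuation), this is the
   ideal generated by the linear forms vanishing on Y. *)
Definition vanishing_ideal : {pred mpoly.mpoly n K} :=
  fun p => `[< forall y, y \in Y -> mpoly.meval (y 0) p = 0 >].

Lemma vanishing_idealP : idealr_closed vanishing_ideal.
Proof.
split=> [||a p q /asboolP hp /asboolP hq].
- by apply/asboolP=> y _; rewrite mpoly.meval0.
- by apply/asboolP => /(_ 0 (mem0v Y))/eqP; rewrite mpoly.meval1 oner_eq0.
- apply/asboolP=> y yY.
  by rewrite mpoly.mevalD mpoly.mevalM hp// hq// mulr0 addr0.
Qed.

HB.instance Definition _ :=
  isIdealr.Build (mpoly.mpoly n K) vanishing_ideal vanishing_idealP.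

Definition coordinate_ring : comNzRingType := {ideal_quot vanishing_ideal}.

Definition coord_const (c : K) : coordinate_ring :=
  (\pi_({ideal_quot vanishing_ideal}) (mpoly.mpolyC n c))%qT.

Definition coord_var (i : 'I_n) : coordinate_ring :=
  (\pi_({ideal_quot vanishing_ideal}) (mpoly.mpolyX K (mpoly.mnm1 i)))%qT.

Variables (R : realType) (v : K -> Rinf R).

Definition Yan : set {ptws coordinate_ring -> Rinf R} :=
  analytification v coord_const.

Definition trop_map (w : {ptws coordinate_ring -> Rinf R}) :
    {ptws 'I_n -> Rinf R} :=
  fun i => w (coord_var i).

Definition Trop : set {ptws 'I_n -> Rinf R} := trop_map @` Yan.

Lemma trop_subproof (w : Yan) : trop_map (val w) \in Trop.
Proof. by apply/mem_set; exists (val w) => //; exact: set_valP. Qed.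

Definition trop (w : Yan) : Trop :=
  exist (fun x => x \in Trop) (trop_map (val w)) (trop_subproof w).

Lemma trop_surjective (xi : Trop) : exists w, trop w = xi.
Proof.
case: (set_valP xi) => w wY wxi; exists (exist (fun x => x \in Yan) w (mem_set wY)).
exact: val_inj.
Qed.

Lemma trop_continuous : continuous trop.
Proof.
apply: continuous_comp_initial; apply: continuous_ptws => i w.
apply: (@continuous_comp _ _ _ (set_val : Yan -> _)
  (fun f : {ptws _ -> _} => f (coord_var i))).
  exact: initial_continuous.
exact: (@proj_continuous _ (fun _ => _) (coord_var i)).
Qed.

End LinearSubspace.

Arguments Yan {K n} Y {R} v.
Arguments Trop {K n} Y {R} v.

(* Main.v *)
Require Import Defs.
From mathcomp Require Import all_boot all_order all_algebra.
From mathcomp Require Import generic_quotient ring_quotient.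
From mathcomp Require Import boolp classical_sets functions reals.
From mathcomp Require Import constructive_ereal ereal topology normedtype.
From mathcomp Require Import -(notations) mpoly.

(* A projection P of K^n onto Y turns f in K[Y] into the polynomial f o P, and
   with it every point xi of the tropical affine space into the valuation
   f |-> Gauss_xi(f o P) = min_m (v(c_m) + m.xi) of K[Y], which depends
   continuously on xi.  By the ultrametric inequality it lies below every
   valuation w of K[Y] with trop(w) = xi, and it lies itself over xi as soon as
   xi_j <= v(P_ij) + xi_i for all i, j.  Among the finitely many projections
   attached to the bases of the coordinate functions on Y one satisfies these
   inequalities: if the j-th one fails, exchanging j with the index i that
   minimizes v(P_ij) + xi_i increases the number of valid columns. *)

Set Implicit Arguments.
Unset Strict Implicit.
Unset Printing Implicit Defensive.

Import Order.TTheory GRing.Theory Num.Theory.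

Local Open Scope classical_set_scope.
Local Open Scope ring_scope.

(** Serves to pick the largest among the monomials attaining a minimum. *)
Lemma seq_max_exists d (T : orderType d) (s : seq T) :
  s != [::] -> exists2 x, x \in s & {in s, forall y, (y <= x)%O}.
Proof.
elim: s => // a [|b s] IH _.
  by exists a; rewrite ?mem_head// => y; rewrite inE => /eqP ->.
have [//|x xs xmax] := IH; have [ax|xa] := leP a x.
- exists x; first by rewrite inE xs orbT.
  by move=> y; rewrite inE => /orP[/eqP ->//|/xmax].
- exists a; first exact: mem_head.
  move=> y; rewrite inE => /orP[/eqP ->//|/xmax yx].
  exact: le_trans yx (ltW xa).
Qed.

(** * Arithmetic of valuations with values in the half-open interval *)

Section Valuation.
Variable R : realType.
Implicit Types x y : \bar R.

Lemma Rinf_neqNy (r : Rinf R) : val r != -oo%E.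
Proof. exact: (set_valP r). Qed.

Lemma adde_neqNy x y : x != -oo%E -> y != -oo%E -> (x + y)%E != -oo%E.
Proof. by case: x; case: y. Qed.

Lemma neqNy_adde_def x y : x != -oo%E -> y != -oo%E -> (x +? y)%E.
Proof. by case: x; case: y. Qed.

Lemma natr_mule_neqNy k x : x != -oo%E -> (k%:R%:E * x)%E != -oo%E.
Proof.
have [->|k0] := posnP k; first by rewrite mul0e.
by case: x => [r||]// _; rewrite gt0_muley// lte_fin ltr0n.
Qed.

Lemma neqNy_addey x : x != -oo%E -> (x + +oo)%E = +oo%E.
Proof. by case: x. Qed.

Lemma lte_ltD x x' y y' : x \is a fin_num -> y \is a fin_num ->
  (x < x')%E -> (y <= y')%E -> (x + y < x' + y')%E.
Proof.
case: x x' y y' => [x||] [x'||] [y||] [y'||]//= _ _; rewrite ?ltry//.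
by rewrite -!EFinD !lte_fin lee_fin => h1 h2; rewrite ltr_leD.
Qed.

Section RingValuation.
Variables (A : comNzRingType) (w : A -> Rinf R).
Hypotheses (w_val : is_valuation w).
Hypotheses (w0 : val (w 0) = +oo%E) (w1 : val (w 1) = 0%E).

Lemma valuationM a b : val (w (a * b)) = (val (w a) + val (w b))%E.
Proof. by case: w_val. Qed.

Lemma valuationD a b : (Order.min (val (w a)) (val (w b)) <= val (w (a + b)))%E.
Proof. by case: w_val. Qed.

(** The shift [x] is there for the weight of a monomial, added to the valuation of its
    coefficient. *)
Lemma le_valuationD c x a b :
  (c <= val (w a) + x -> c <= val (w b) + x -> c <= val (w (a + b)%R) + x)%E.
Proof.
move=> ca cb; apply: le_trans (leeD (valuationD a b) (lexx x)).
by rewrite minEle; case: ifP.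
Qed.

Lemma lt_valuationD c x a b :
  (c < val (w a) + x -> c < val (w b) + x -> c < val (w (a + b)%R) + x)%E.
Proof.
move=> ca cb; apply: lt_le_trans (leeD (valuationD a b) (lexx x)).
by rewrite minEle; case: ifP.
Qed.

Lemma le_valuation_sum c x I (r : seq I) (P : pred I) (F : I -> A) :
  x != -oo%E -> (forall i, P i -> (c <= val (w (F i)) + x)%E) ->
  (c <= val (w (\sum_(i <- r | P i) F i)) + x)%E.
Proof.
move=> xN h; apply: (big_ind (fun a => (c <= val (w a) + x)%E)) => //.
- by rewrite w0 addeC neqNy_addey// leey.
- by move=> a b; exact: le_valuationD.
Qed.

(** The bound [c < +oo] covers the empty sum, whose value is +oo. *)
Lemma lt_valuation_sum c x I (r : seq I) (P : pred I) (F : I -> A) :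
  x != -oo%E -> (c < +oo)%E -> (forall i, P i -> (c < val (w (F i)) + x)%E) ->
  (c < val (w (\sum_(i <- r | P i) F i)) + x)%E.
Proof.
move=> xN cy h; apply: (big_ind (fun a => (c < val (w a) + x)%E)) => //.
- by rewrite w0 addeC neqNy_addey.
- by move=> a b; exact: lt_valuationD.
Qed.

Lemma valuationX a k : val (w (a ^+ k)) = (k%:R%:E * val (w a))%E.
Proof.
elim: k => [|k IH]; first by rewrite expr0 w1 mul0e.
by rewrite exprS valuationM IH -natr1 addrC EFinD ge0_muleDl ?lee_fin// mul1e.
Qed.

Lemma valuation_prod I (r : seq I) (F : I -> A) :
  val (w (\prod_(i <- r) F i)) = (\sum_(i <- r) val (w (F i)))%E.
Proof.
by elim: r => [|i r IH]; rewrite ?big_nil// !big_cons valuationM IH.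
Qed.

Lemma valuationN1 : val (w (-1)) = 0%E.
Proof.
have := valuationM (-1) (-1); rewrite mulrNN mulr1 w1.
case: (val (w (-1))) => [r||]//=; rewrite -EFinD => -[/esym/eqP].
by rewrite -mulr2n mulrn_eq0/= => /eqP ->.
Qed.

Lemma valuationN a : val (w (- a)) = val (w a).
Proof. by rewrite -mulN1r valuationM valuationN1 add0e. Qed.

End RingValuation.

Section FieldValuation.
Variables (K : fieldType) (v : K -> Rinf R).
Hypothesis v_val : is_field_valuation v.
Let nu c := val (v c).

Lemma field_valuation_val : is_valuation v. Proof. by case: v_val. Qed.

Lemma field_valuation0 : val (v 0) = +oo%E.
Proof. by case: v_val => _ h; apply/h. Qed.

Lemma field_valuation_fin c : c != 0 -> nu c \is a fin_num.
Proof.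
move=> c0; rewrite fin_numE Rinf_neqNy/=; apply: contra_neq c0.
by case: v_val => _ h /h.
Qed.

Lemma field_valuation1 : val (v 1) = 0%E.
Proof.
have := valuationM field_valuation_val 1 1; rewrite mulr1.
have := field_valuation_fin (oner_neq0 K); rewrite /nu.
case: (val (v 1)) => [r||]//= _; rewrite -EFinD => -[/eqP].
by rewrite -subr_eq0 opprD addrA subrr sub0r oppr_eq0 => /eqP ->.
Qed.

Lemma field_valuationV c : c != 0 -> nu c^-1 = (- nu c)%E.
Proof.
move=> c0; have := valuationM field_valuation_val c c^-1.
rewrite divff// field_valuation1.
have := field_valuation_fin c0.
have : c^-1 != 0 by rewrite invr_eq0.
move=> /field_valuation_fin; rewrite /nu.
case: (val (v c)) (val (v c^-1)) => [r||] [s||]//= _ _.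
rewrite -EFinD => -[/eqP]; rewrite eq_sym addrC addr_eq0 => /eqP ->.
by rewrite EFinN.
Qed.

(** * Gauss valuations of the polynomial ring *)

Section Gauss.
Variable n : nat.
Implicit Types (xi : 'I_n -> \bar R) (p q : mpoly n K) (m : multinom n).

(** Since 0 * +oo = 0 in [\bar R], a variable absent from [m] contributes nothing even where its
    weight is +oo. *)
Definition mweight xi m : \bar R := (\sum_(i < n) (m i)%:R%:E * xi i)%E.

Definition term_val xi p m : \bar R := (nu (mcoeff m p) + mweight xi m)%E.

Definition gauss xi p : \bar R :=
  \big[Order.min/+oo%E]_(m <- msupp p) term_val xi p m.

Lemma mweightD xi m1 m2 :
  mweight xi (mnm_add m1 m2) = (mweight xi m1 + mweight xi m2)%E.
Proof.
rewrite /mweight -big_split/=; apply: eq_bigr => i _.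
by rewrite mnmDE natrD EFinD ge0_muleDl ?lee_fin.
Qed.

Lemma mweight_neqNy xi m : (forall i, xi i != -oo%E) -> mweight xi m != -oo%E.
Proof.
move=> xiN; rewrite /mweight; apply: (big_ind (fun x => x != -oo%E)) => //.
- by move=> x y; exact: adde_neqNy.
- by move=> i _; exact: natr_mule_neqNy.
Qed.

Lemma mweightU xi i : mweight xi (mnm1 i) = xi i.
Proof.
rewrite /mweight (bigD1 i)//= big1 ?mnm1E ?eqxx ?mul1e ?adde0// => j ji.
by rewrite mnm1E eq_sym (negPf ji) mul0e.
Qed.

Lemma mweight0 xi : mweight xi mnm0 = 0%E.
Proof. by rewrite /mweight big1// => i _; rewrite mnm0E mul0e. Qed.

Section FixedWeights.
Variable xi : 'I_n -> \bar R.
Hypothesis xiN : forall i, xi i != -oo%E.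

Lemma term_val_notin p m : m \notin msupp p -> term_val xi p m = +oo%E.
Proof.
move=> mp; rewrite /term_val /nu memN_msupp_eq0// field_valuation0 addeC.
by rewrite neqNy_addey// mweight_neqNy.
Qed.

Lemma term_val_neqNy p m : term_val xi p m != -oo%E.
Proof. by rewrite adde_neqNy ?mweight_neqNy// Rinf_neqNy. Qed.

Lemma le_gauss c p :
  (forall m, (c <= term_val xi p m)%E) -> (c <= gauss xi p)%E.
Proof.
move=> h; apply: (big_ind (fun x => (c <= x)%E)) => //; first exact: leey.
by move=> x y cx cy; rewrite minEle; case: ifP.
Qed.

Lemma gauss_le p m : (gauss xi p <= term_val xi p m)%E.
Proof.
have [|/term_val_notin ->] := boolP (m \in msupp p); last exact: leey.
rewrite /gauss; elim: (msupp p) => // a s IH; rewrite inE big_cons.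
by move=> /orP[/eqP ->|/IH h]; rewrite ge_min ?lexx// h orbT.
Qed.

Lemma gauss_attained p : gauss xi p != +oo%E ->
  exists2 m, m \in msupp p & gauss xi p = term_val xi p m.
Proof.
rewrite /gauss; elim: (msupp p) => [|a s IH]; first by rewrite big_nil eqxx.
rewrite big_cons minEle; case: ifP => _ h; first by exists a; rewrite ?mem_head.
by have [m ms e] := IH h; exists m => //; rewrite inE ms orbT.
Qed.

Lemma gauss_neqNy p : gauss xi p != -oo%E.
Proof.
have [->//|/gauss_attained[m _ ->]] := eqVneq (gauss xi p) +oo%E.
exact: term_val_neqNy.
Qed.

Lemma gaussD p q :
  (Order.min (gauss xi p) (gauss xi q) <= gauss xi (p + q)%R)%E.
Proof.
apply: le_gauss => m; rewrite /term_val mcoeffD.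
apply: (le_valuationD field_valuation_val).
- by rewrite ge_min gauss_le.
- by rewrite ge_min (gauss_le q) orbT.
Qed.

Lemma gaussM_ge p q : (gauss xi p + gauss xi q <= gauss xi (p * q)%R)%E.
Proof.
apply: le_gauss => m; rewrite /term_val mcoeffM.
apply: (le_valuation_sum field_valuation_val field_valuation0).
  exact: mweight_neqNy.
move=> k /eqP em.
have -> : mweight xi m = (mweight xi k.1 + mweight xi k.2)%E.
  by rewrite -mweightD -em.
by rewrite (valuationM field_valuation_val) addeACA leeD// gauss_le.
Qed.

(** Finitely many monomials attain the minimum; the largest of them in the monomial order is
    taken. *)
Lemma gauss_attained_last p : gauss xi p != +oo%E ->
  exists2 m, gauss xi p = term_val xi p m &
    forall m', (m < m')%O -> (gauss xi p < term_val xi p m')%E.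
Proof.
move=> gp; pose s := [seq m <- msupp p | term_val xi p m == gauss xi p].
have [|m ms mmax] := @seq_max_exists _ _ s.
  have [m mp e] := gauss_attained gp.
  have : m \in s by rewrite mem_filter e eqxx.
  by case: (s).
exists m; first by move: ms; rewrite mem_filter => /andP[/eqP ->].
move=> m' mm'; rewrite lt_neqAle gauss_le andbT; apply/negP => /eqP e.
have : m' \in s.
  rewrite mem_filter -e eqxx/=; apply: contraNT gp => /term_val_notin h.
  by rewrite e h.
by move=> /mmax; rewrite leNgt mm'.
Qed.

(* The coefficient of [p * q] at the sum of the last monomials attaining the
   minima for [p] and [q] has exactly one term of minimal valuation. *)
Lemma gaussM p q : gauss xi (p * q) = (gauss xi p + gauss xi q)%E.
Proof.
apply/eqP; rewrite eq_le gaussM_ge andbT.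
have [->|gp] := eqVneq (gauss xi p) +oo%E.
  by rewrite addeC neqNy_addey ?gauss_neqNy// leey.
have [->|gq] := eqVneq (gauss xi q) +oo%E.
  by rewrite neqNy_addey ?gauss_neqNy// leey.
have [m1 e1 l1] := gauss_attained_last gp.
have [m2 e2 l2] := gauss_attained_last gq.
have fp : gauss xi p \is a fin_num by rewrite fin_numE gp gauss_neqNy.
have fq : gauss xi q \is a fin_num by rewrite fin_numE gq gauss_neqNy.
pose m := mnm_add m1 m2.
apply: le_trans (gauss_le _ m) _.
(* [mcoeffM] sums over pairs of monomials of degree below [(mdeg m).+1], so the distinguished pair
   is packed with these bounds. *)
have h1 : (mdeg m1 < (mdeg m).+1)%N by rewrite ltnS mdegD leq_addr.
have h2 : (mdeg m2 < (mdeg m).+1)%N by rewrite ltnS mdegD leq_addl.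
pose k0 := (BMultinom h1, BMultinom h2).
rewrite /term_val mcoeffM (bigD1 k0) ?eqxx//=.
set a := mcoeff m1 p * mcoeff m2 q; set b := (X in nu (_ + X)).
have ea : (gauss xi p + gauss xi q)%E = (nu a + mweight xi m)%E.
  by rewrite e1 e2 addeACA /nu (valuationM field_valuation_val) mweightD.
have gb : (gauss xi p + gauss xi q < nu b + mweight xi m)%E.
  apply: (lt_valuation_sum field_valuation_val field_valuation0).
  - exact: mweight_neqNy.
  - by rewrite ltey; move: fp fq; case: (gauss xi p); case: (gauss xi q).
  move=> [[m1' h1'] [m2' h2']] /= /andP[/eqP em ne].
  rewrite em mweightD (valuationM field_valuation_val) addeACA.
  (* In another decomposition of [m], either m1' > m1 or, the order being compatible with addition,
     m2' > m2. That factor is strictly above its minimum, and the other is at least its own. *)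
  have [lt1|le1] := ltP m1 m1'.
    by apply: lte_ltD => //; [exact: l1|exact: gauss_le].
  rewrite [ltLHS]addeC [ltRHS]addeC; apply: lte_ltD => //; last exact: gauss_le.
  apply: l2; rewrite ltNge; apply/negP => le2.
  move: le1; rewrite le_eqVlt => /orP[/eqP e|lt1]; last first.
    by have := ltmc_le_add lt1 le2; rewrite -em ltxx.
  have e' : m2' = m2 by apply: (@addmI _ m1); rewrite -[in LHS]e -em.
  by case/negP: ne; apply/eqP; congr pair; apply: val_inj.
(* Otherwise both [a + b] and [b] would have valuation above that of [a], and hence so would their
   difference [a]. *)
rewrite ea leNgt; apply/negP => /[dup] lt.
suff : (nu a + mweight xi m < nu (a + b - b)%R + mweight xi m)%E.
  by rewrite addrK ltxx.
apply: (lt_valuationD field_valuation_val) => //.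
by rewrite (valuationN field_valuation_val) ?field_valuation1 // -ea.
Qed.

Lemma gaussC c : gauss xi (mpolyC n c) = nu c.
Proof.
have e0 : term_val xi (mpolyC n c) mnm0 = nu c.
  by rewrite /term_val mcoeffC eqxx mulr1 mweight0 adde0.
apply/eqP; rewrite eq_le -{1}e0 gauss_le/=; apply: le_gauss => m.
have [->|m0] := eqVneq m mnm0; first by rewrite e0.
rewrite /term_val mcoeffC (negPf m0) mulr0 {2}/nu field_valuation0 addeC.
by rewrite neqNy_addey ?leey// mweight_neqNy.
Qed.

Lemma gauss_linear_ge c (a : 'I_n -> K) :
  (forall i, (c <= nu (a i) + xi i)%E) ->
  (c <= gauss xi (\sum_i a i *: mpolyX K (mnm1 i))%R)%E.
Proof.
move=> h; apply: le_gauss => m; rewrite /term_val raddf_sum/=.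
apply: (le_valuation_sum field_valuation_val field_valuation0).
  exact: mweight_neqNy.
move=> i _; rewrite linearZ/= mcoeffX; have [<-|_] := eqVneq (mnm1 i) m.
  by rewrite mulr1 mweightU; exact: h.
by rewrite mulr0 field_valuation0 addeC neqNy_addey ?leey// mweight_neqNy.
Qed.

End FixedWeights.

(** For fixed [p] this is a finite minimum of finite sums of continuous functions. *)
Lemma continuous_gauss (X : topologicalType) (xi : X -> 'I_n -> \bar R) p :
  (forall (x : X) i, xi x i != -oo%E) -> (forall i, continuous (xi^~ i)) ->
  continuous (fun t : X => gauss (xi t) p).
Proof.
move=> xiN xic.
have wc m : continuous (fun t : X => mweight (xi t) m).
  (* Continuity of addition fails at opposite infinities, so the induction also records that partial
     sums avoid -oo. *)
  have: forall r : seq 'I_n,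
    continuous (fun t : X => (\sum_(i <- r) (m i)%:R%:E * xi t i)%E) /\
    forall x : X, (\sum_(i <- r) (m i)%:R%:E * xi x i)%E != -oo%E.
    elim=> [|i r [rc rN]].
      split=> [x|x]; last by rewrite big_nil.
      by under eq_fun do rewrite big_nil; exact: cvg_cst.
    split=> x; last by rewrite big_cons adde_neqNy// natr_mule_neqNy.
    under eq_fun do rewrite big_cons.
    apply: cvgeD; last exact: rc.
      by rewrite neqNy_adde_def ?natr_mule_neqNy.
    by apply: cvgeZl => //; exact: xic.
  by move=> /(_ (index_enum _))[].
rewrite /gauss; elim: (msupp p) => [|m r IH].
  by under eq_fun do rewrite big_nil; move=> x; exact: cvg_cst.
under eq_fun do rewrite big_cons.
apply: (@min_fun_continuous _ _ _ (fun t : X => term_val (xi t) p m)) => // x.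
apply: cvgeD; [|exact: cvg_cst|exact: wc].
by rewrite neqNy_adde_def ?mweight_neqNy ?Rinf_neqNy.
Qed.

End Gauss.
End FieldValuation.
End Valuation.

(** * Projections onto [Y] attached to bases of coordinates, and basis exchange *)

Section CoordinateProjections.
Variables (K : fieldType) (n : nat) (Y : {vspace 'rV[K]_n}).
Implicit Types (P : 'M[K]_n) (B : {set 'I_n}).

Definition projects_onto P :=
  (forall y, y \in Y -> y *m P = y) /\ (forall z : 'rV_n, z *m P \in Y).

(* The coordinates in [B] form a basis of the dual of [Y], and column [j] of
   [P] expresses the [j]-th coordinate in this basis. *)
Definition basis_projection B P :=
  [/\ projects_onto P, forall i j, i \notin B -> P i j = 0 &
      forall i j, i \in B -> j \in B -> P i j = (i == j)%:R].

(** The rows of [P] lie in [Y], so [P'] fixes them. For [i] in [B], the identity block of [P] and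
    the zero rows of [P'] outside [B] also turn row [i] of [P *m P'] into row [i] of [P']. *)
Lemma basis_projection_inj B P P' :
  basis_projection B P -> basis_projection B P' -> P = P'.
Proof.
move=> [[_ PY] P0 PB] [[YP' _] P'0 P'B]; apply/matrixP => i j.
have [iB|iB] := boolP (i \in B); last by rewrite P0// P'0.
have : row i P *m P' = row i P by apply: YP'; rewrite rowE; exact: PY.
move=> /matrixP/(_ 0 j); rewrite !mxE (bigD1 i)//= !mxE PB// eqxx mul1r.
rewrite big1 ?addr0// => k ki; rewrite mxE.
have [kB|kB] := boolP (k \in B); last by rewrite P'0// mulr0.
by rewrite PB// eq_sym (negPf ki) mul0r.
Qed.

(** Take [B] minimal among the sets of coordinates separating the points of [Y]. By minimality each
    [i] in [B] has a vector of [Y] that vanishes at the rest of [B] but not at [i]; rescaled, these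
    vectors form the dual basis and are the nonzero rows of [P]. *)
Lemma basis_projection_exists : exists B P, basis_projection B P.
Proof.
pose Q B :=
  `[< forall y, y \in Y -> (forall k, k \in B -> y 0 k = 0) -> y = 0 >].
have [|B /minsetP[/asboolP QB Bmin] _] := @minset_exists _ Q [set: _]%SET.
  by apply/asboolP => y _ y0; apply/rowP => k; rewrite y0 ?inE// mxE.
have /choice[f fP] : forall i, exists y, i \in B ->
    y \in Y /\ forall k, k \in B -> y 0 k = (i == k)%:R.
  move=> i; have [iB|] := boolP (i \in B); last by exists 0.
  have /asboolPn/existsNP[y /not_implyP[yY /not_implyP[yB y0]]] : ~~ Q (B :\ i).
    apply/negP => /Bmin/(_ (subD1set _ _)) e.
    by move: iB; rewrite -e !inE eqxx.
  have yi : y 0 i != 0.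
    apply: contra_notN y0 => /eqP yi; apply: QB => // k kB.
    by have [->//|ki] := eqVneq k i; apply: yB; rewrite !inE ki.
  exists ((y 0 i)^-1 *: y) => _; split; first exact: memvZ.
  move=> k kB; rewrite mxE; have [<-|ik] := eqVneq i k; first by rewrite mulVf.
  have -> : y 0 k = 0 by apply: yB; rewrite !inE eq_sym ik.
  by rewrite mulr0.
pose P : 'M_n := \matrix_(i, j) if i \in B then f i 0 j else 0.
have PY z : z *m P \in Y.
  rewrite mulmx_sum_row; apply: memv_suml => i _; apply: memvZ.
  have [iB|iB] := boolP (i \in B).
    have -> : row i P = f i by apply/rowP => j; rewrite !mxE iB.
    by case: (fP i iB).
  have -> : row i P = 0 by apply/rowP => j; rewrite !mxE (negPf iB).
  exact: mem0v.
have PB i j : i \in B -> j \in B -> P i j = (i == j)%:R.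
  by move=> iB jB; rewrite mxE iB; have [_ ->] := fP i iB.
have P0 i j : i \notin B -> P i j = 0 by move=> iB; rewrite mxE (negPf iB).
exists B, P; split=> //; split=> // y yY.
(* The difference of [y] and [y *m P] lies in [Y] and vanishes at the coordinates in [B]. *)
apply/eqP; rewrite -subr_eq0; apply/eqP/QB; first by rewrite memvB// PY.
move=> k kB; rewrite mxE [X in _ + X]mxE mxE (bigD1 k)//= PB// eqxx mulr1.
rewrite big1 ?addr0 ?subrr// => i ik.
have [iB|iB] := boolP (i \in B); last by rewrite P0// mulr0.
by rewrite PB// (negPf ik) mulr0.
Qed.

(** Solves the relation x_j = sum_k P_kj x_k on [Y] for x_i and substitutes the result into every
    column, so that x_j replaces x_i in the basis. *)
Definition exchange P i j : 'M[K]_n :=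
  P - (P i j)^-1 *: (col j (P - 1%:M) *m row i P).

Lemma exchangeE P i j k l : exchange P i j k l =
  P k l - (P k j - (k == j)%:R) * (P i j)^-1 * P i l.
Proof. by rewrite !mxE big_ord1 !mxE mulrA [_^-1 * _]mulrC. Qed.

(** The rank-one correction vanishes on [Y] through its factor [P - 1], and its image is spanned by
    row [i] of [P], which lies in [Y]. *)
Lemma exchange_projects_onto P i j :
  projects_onto P -> projects_onto (exchange P i j).
Proof.
move=> [YP PY]; split=> [y yY|z]; rewrite /exchange mulmxBr -scalemxAr mulmxA.
- rewrite YP// colE mulmxA mulmxBr mulmx1 YP// subrr !mul0mx scaler0 subr0//.
- by rewrite rowE mulmxA memvB// memvZ.
Qed.

Lemma exchange_basis_projection B P i j : i \in B -> j \notin B -> P i j != 0 ->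
  basis_projection B P -> basis_projection (j |: B :\ i) (exchange P i j).
Proof.
move=> iB jB Pij [Pp P0 PB].
have ij : i != j by apply: contraNneq jB => <-.
split; first exact: exchange_projects_onto.
- move=> k l; rewrite exchangeE !inE negb_or negb_and negbK.
  move=> /andP[kj /orP[/eqP ->|kB]]; last first.
    by rewrite (P0 k l)// (P0 k j)// (negPf kj) subr0 !mul0r subr0.
  by rewrite (negPf ij) subr0 divff// mul1r subrr.
- move=> k l; rewrite exchangeE !inE => hk hl.
  (* Column [j] becomes a unit vector; any other column [l] of the new basis is unchanged, since
     P_il = 0. *)
  have [->|lj] := eqVneq l j.
    rewrite -mulrA mulVf// mulr1 opprB addrC subrK//.
  move: hl; rewrite (negPf lj)/= => /andP[li lB].
  rewrite (PB i l)// [i == l]eq_sym (negPf li) mulr0 subr0.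
  move: hk => /orP[/eqP ->|/andP[_ kB]]; last by rewrite PB.
  by rewrite P0// eq_sym (negPf lj).
Qed.

End CoordinateProjections.

(** * Projections adapted to a tropical point *)

Section AdaptedProjections.
Variables (R : realType) (K : fieldType) (v : K -> Rinf R).
Hypothesis v_val : is_field_valuation v.
Variables (n : nat) (Y : {vspace 'rV[K]_n}).
Implicit Types (P : 'M[K]_n) (B : {set 'I_n}) (xi : 'I_n -> \bar R).

(** Bounds below by xi_j the Gauss valuation at [xi] of the linear form with coefficients in column
    [j]. *)
Definition adapted_at xi P j := [forall i, xi j <= val (v (P i j)) + xi i]%E.

Definition adapted xi P := [forall j, adapted_at xi P j].

(** The correction to entry [(k, l)] is a * P_il / P_ij up to sign. By the choice of [i], v(a) +
    xi_k is at least v(P_ij) + xi_i; for k = j, where a = -1, this is the failure of column [j]. So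
    the shifted correction is at least v(P_il) + xi_i, hence at least xi_l. *)
Lemma exchange_adapted_at xi P i j l : (forall i, xi i != -oo%E) ->
  P j j = 0 ->
  (forall k, (val (v (P i j)) + xi i <= val (v (P k j)) + xi k)%E) ->
  (val (v (P i j)) + xi i < xi j)%E ->
  adapted_at xi P l -> adapted_at xi (exchange P i j) l.
Proof.
move=> xiN Pjj imin ij /forallP lP; apply/forallP => k; rewrite exchangeE.
have vM := valuationM (field_valuation_val v_val).
have Pij : P i j != 0.
  apply: contraTneq ij => ->; rewrite field_valuation0// addeC neqNy_addey//.
  by rewrite -leNgt leey.
apply: (le_valuationD (field_valuation_val v_val)); first exact: lP.
rewrite (valuationN (field_valuation_val v_val)) ?field_valuation1//.
set a := P k j - _.
have ha : (val (v (P i j)) + xi i <= val (v a) + xi k)%E.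
  rewrite /a; have [->|kj] := eqVneq k j; last by rewrite subr0.
  rewrite Pjj sub0r (valuationN (field_valuation_val v_val));
    rewrite ?field_valuation1//.
  by rewrite add0e ltW.
rewrite !vM field_valuationV//.
have := field_valuation_fin v_val Pij; move: ha (lP i).
move: (val (v (P i j))) (val (v a)) (val (v (P i l))) => b a' c ha li bfin.
apply: le_trans li _; rewrite -[in leLHS](subeK c bfin) -[leLHS]addeA.
have -> : (a' - b + c + xi k = c - b + (a' + xi k))%E.
  by rewrite -addeA addeACA [RHS]addeACA [(c + a')%E]addeC.
by rewrite leeD.
Qed.

(** After the exchange, column [j] is the [j]-th unit vector. *)
Lemma adapted_at_exchange xi P i j : P i j != 0 ->
  (forall i, xi i != -oo%E) -> adapted_at xi (exchange P i j) j.
Proof.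
move=> Pij xiN; apply/forallP => k; rewrite exchangeE -mulrA mulVf// mulr1.
rewrite opprB [P k j + _]addrC subrK; have [->|_] := eqVneq k j.
  by rewrite field_valuation1// add0e.
by rewrite field_valuation0// addeC neqNy_addey// leey.
Qed.

Lemma adapted_basis_projection xi : (forall i, xi i != -oo%E) ->
  exists B P, basis_projection Y B P /\ adapted xi P.
Proof.
move=> xiN; pose good P := [set j | adapted_at xi P j]%SET.
(* [k] bounds the number of failing columns, which every exchange lowers. *)
suff H k B P : (n - #|good P| <= k)%N -> basis_projection Y B P ->
    exists B P, basis_projection Y B P /\ adapted xi P.
  by have [B [P BP]] := basis_projection_exists Y; exact: (H _ B P (leqnn _)).
elim: k => [|k IH] in B P *; move=> gk BP.
  exists B, P; split=> //; apply/forallP => j.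
  suff /setP/(_ j) : good P = [set: _]%SET by rewrite !inE.
  apply/eqP; rewrite eqEcard finset.subsetT cardsT card_ord.
  by rewrite -subn_eq0 -leqn0.
have [ad|] := boolP (adapted xi P); first by exists B, P.
rewrite negb_forall => /existsP[j jP].
move: (jP); rewrite negb_forall => /existsP[i0 hi0].
have [i _ imin] :=
  @arg_minP _ _ _ i0 predT (fun i => val (v (P i j)) + xi i)%E isT.
have ij : (val (v (P i j)) + xi i < xi j)%E.
  by apply: le_lt_trans (imin i0 isT) _; rewrite ltNge.
have Pij : P i j != 0.
  apply: contraTneq ij => ->; rewrite field_valuation0// addeC neqNy_addey//.
  by rewrite -leNgt leey.
have [Pp P0 PB] := BP.
have iB : i \in B by apply: contraNT Pij => iB; rewrite P0.
(* For [j] in [B], column [j] restricted to [B] would be a unit vector, forcing i = j and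
   contradicting the strict inequality [ij]. *)
have jB : j \notin B.
  apply/negP => jB; move: Pij ij; rewrite PB//; have [<-|] := eqVneq i j.
    by rewrite field_valuation1// add0e ltxx.
  by rewrite eqxx.
apply: IH (exchange_basis_projection iB jB Pij BP).
rewrite -ltnS; apply: leq_trans gk; apply: ltn_sub2l.
  rewrite -[X in (_ < X)%N]card_ord -cardsT; apply: fintype.proper_card.
  rewrite finset.properT; apply: contraNneq jP.
  by move=> /setP/(_ j); rewrite !inE => ->.
apply: fintype.proper_card; apply/fintype.properP; split.
  apply/fintype.subsetP => l; rewrite !inE; apply: exchange_adapted_at => //.
  - exact: P0.
  - by move=> k'; exact: imin.
exists j; rewrite inE//; exact: adapted_at_exchange.
Qed.

(** Each [B] carries at most one basis projection, so a single finite list serves all [xi]. *)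
Lemma finite_adapted_projections : exists s : seq 'M[K]_n,
  {in s, forall P, projects_onto Y P} /\
  forall xi, (forall i, xi i != -oo%E) -> exists2 P, P \in s & adapted xi P.
Proof.
pose s := [seq xget 0 [set P | basis_projection Y B P] |
  B <- enum {set 'I_n} & `[< exists P, basis_projection Y B P >]].
have sB B P : basis_projection Y B P ->
    xget 0 [set P | basis_projection Y B P] = P.
  move=> BP; apply: (basis_projection_inj _ BP).
  by apply: (@xgetPex _ 0 [set P | basis_projection Y B P]); exists P.
exists s; split=> [Q /mapP[B]|xi /adapted_basis_projection[B [P [BP ad]]]].
  rewrite mem_filter => /andP[/asboolP[P BP] _] ->.
  by rewrite (sB _ _ BP); case: BP.
exists P => //; apply/mapP; exists B; last by rewrite (sB _ _ BP).
by rewrite mem_filter mem_enum inE andbT; apply/asboolP; exists P.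
Qed.

End AdaptedProjections.

(** * Continuity of finite maxima *)

Lemma continuous_bigmax (R : realType) (X : topologicalType) I (s : seq I)
    (F : I -> X -> \bar R) : (forall i, continuous (F i)) ->
  continuous (fun x => \big[Order.max/-oo%E]_(i <- s) F i x).
Proof.
move=> Fc; elim: s => [|i s IH].
  by under eq_fun do rewrite big_nil; move=> x; exact: cvg_cst.
under eq_fun do rewrite big_cons.
exact: max_fun_continuous.
Qed.

(** * Nonzero polynomials over an infinite field have nonvanishing points *)

Section NonvanishingPoint.
Variables (K : fieldType) (a : nat -> K).
Hypothesis a_inj : injective a.

Lemma poly_nonroot (q : {poly K}) : q != 0 -> exists t, q.[t] != 0.
Proof.
move=> q0; apply/not_existsP => h.
pose r := [seq a k | k <- iota 0 (size q)].
have qr : all (root q) r.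
  by apply/allP => t _; apply/rootP/eqP/negPn/negP; exact: h.
have : uniq r by rewrite map_inj_uniq// iota_uniq.
by move=> /(max_poly_roots q0 qr); rewrite size_map size_iota ltnn.
Qed.

(** Induction on the number of variables. Here [r] is the coefficient in [p] of the power of the
    first variable occurring in the leading monomial. At a point [z] where [r] does not vanish, [p]
    specializes to a nonzero polynomial [q] in the first variable. *)
Lemma mpoly_nonroot n (p : mpoly n K) : p != 0 -> exists z, meval z p != 0.
Proof.
elim: n p => [|n IH] p p0.
  exists (fun=> 0); rewrite (nvar0_mpolyC p) mevalC.
  by apply: contraNneq p0 => e; rewrite (nvar0_mpolyC p) e.
pose tl (m : multinom n.+1) : multinom n :=
  Multinom (mktuple (fun i : 'I_n => m (lift ord0 i))).
have tlE m i : tl m i = m (lift ord0 i) by exact: mnmE.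
have tl_inj (m m' : multinom n.+1) : m ord0 = m' ord0 -> tl m = tl m' -> m = m'.
  move=> e0 e; apply/mnmP => i; have [j ->|->//] := unliftP ord0 i.
  by rewrite -!tlE e.
set m0 := mlead p.
pose r : mpoly n K :=
  \sum_(m <- msupp p | m ord0 == m0 ord0) mcoeff m p *: mpolyX K (tl m).
have r0 : r != 0.
  suff : mcoeff (tl m0) r != 0 by apply: contraNneq => ->; rewrite mcoeff0.
  rewrite raddf_sum/= -big_filter (bigD1_seq m0)/=; first last.
  - by rewrite filter_uniq ?msupp_uniq.
  - by rewrite mem_filter eqxx mlead_supp.
  rewrite mcoeffZ mcoeffX eqxx mulr1 big_seq_cond big1 ?addr0.
    by rewrite -mcoeff_msupp mlead_supp.
  move=> m /andP[]; rewrite mem_filter => /andP[/eqP e _] mm0.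
  rewrite mcoeffZ mcoeffX; case: eqP => [/(tl_inj _ _ e)/eqP|_].
    by rewrite (negPf mm0).
  by rewrite mulr0.
have [z rz] := IH r r0.
pose q : {poly K} := \sum_(m <- msupp p)
  (mcoeff m p * \prod_i z i ^+ m (lift ord0 i)) *: 'X^(m ord0).
have [|t qt] := @poly_nonroot q.
  apply: contraNneq rz => q0; suff -> : meval z r = q`_(m0 ord0).
    by rewrite q0 coef0.
  rewrite /r /q raddf_sum coef_sum big_mkcond/=; apply: eq_bigr => m _.
  rewrite coefZ coefXn eq_sym; case: eqP => _; last by rewrite mulr0.
  rewrite mulr1 mevalZ mevalX; congr (_ * _); apply: eq_bigr => i _.
  by rewrite tlE.
exists (fun i => oapp z t (unlift ord0 i)); apply: contraNneq qt => pz.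
rewrite -[X in _ == X]pz mevalE horner_sum; apply/eqP/eq_bigr => m _.
rewrite hornerZ hornerXn big_ord_recl unlift_none/= -mulrA [_ * t ^+ _]mulrC.
by congr (_ * (_ * _)); apply: eq_bigr => i _; rewrite liftK.
Qed.

End NonvanishingPoint.

(** * Pulling back polynomials along a projection *)

Section Substitution.
Variables (K : fieldType) (n : nat) (Y : {vspace 'rV[K]_n}).
Implicit Types (P : 'M[K]_n) (f g : mpoly n K).

Definition lin_subst P f : mpoly n K :=
  comp_mpoly (mktuple (fun j => \sum_i P i j *: mpolyX K (mnm1 i))) f.

Lemma lin_substX P j :
  lin_subst P (mpolyX K (mnm1 j)) = \sum_i P i j *: mpolyX K (mnm1 i).
Proof. by rewrite /lin_subst comp_mpolyXU -tnth_nth tnth_mktuple. Qed.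

Lemma meval_lin_subst P f (z : 'rV[K]_n) :
  meval (z 0) (lin_subst P f) = meval ((z *m P) 0) f.
Proof.
rewrite /lin_subst comp_mpoly_meval; apply: meval_eq => j.
rewrite tnth_mktuple raddf_sum mxE; apply: eq_bigr => i _.
by rewrite /= mevalZ mevalXU mulrC.
Qed.

(** The pulled-back polynomial vanishes at every point of the affine space, because [P] maps into
    [Y]; over an infinite field it is therefore zero. *)
Lemma lin_subst_vanish P f : (exists a : nat -> K, injective a) ->
  projects_onto Y P -> f \in vanishing_ideal Y -> lin_subst P f = 0.
Proof.
move=> [a a_inj] [_ PY] /asboolP fY; apply/eqP; apply: contrapT => /negP.
move=> /(mpoly_nonroot a_inj)[z]; have -> : z = (\row_i z i) 0.
  by apply/funext => i; rewrite mxE.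
by rewrite meval_lin_subst fY// eqxx.
Qed.

Definition restriction f : coordinate_ring Y :=
  (\pi_({ideal_quot (vanishing_ideal Y)}) f)%qT.

Lemma restriction_eq f g :
  (forall y, y \in Y -> meval (y 0) f = meval (y 0) g) ->
  restriction f = restriction g.
Proof.
move=> fg; apply/eqP; rewrite /restriction -Quotient.idealrBE.
by apply/asboolP => y yY; rewrite mevalB fg// subrr.
Qed.

Lemma restriction_lin_subst P f :
  projects_onto Y P -> restriction (lin_subst P f) = restriction f.
Proof.
by move=> [YP _]; apply: restriction_eq => y yY; rewrite meval_lin_subst YP.
Qed.

(** Makes the substitution well defined on the coordinate ring of [Y]. *)
Lemma lin_subst_restriction_eq P f g : (exists a : nat -> K, injective a) ->
  projects_onto Y P -> restriction f = restriction g ->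
  lin_subst P f = lin_subst P g.
Proof.
move=> Kinf PY /eqP; rewrite /restriction -Quotient.idealrBE.
move=> /(lin_subst_vanish Kinf PY)/eqP; rewrite /lin_subst comp_mpolyB.
by rewrite subr_eq0 => /eqP.
Qed.

End Substitution.

(** * Lifting tropical points to valuations of the coordinate ring *)

Section TropicalLift.
Variables (R : realType) (K : fieldType) (v : K -> Rinf R).
Hypothesis v_val : is_field_valuation v.
Hypothesis Kinf : exists a : nat -> K, injective a.
Variables (n : nat) (Y : {vspace 'rV[K]_n}).
Implicit Types (P : 'M[K]_n) (xi : 'I_n -> Rinf R) (f g : mpoly n K).
Implicit Types (q : coordinate_ring Y).

Let weights xi i := val (xi i).

Lemma weights_neqNy xi i : weights xi i != -oo%E.
Proof. exact: Rinf_neqNy. Qed.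

(** [repr] chooses a polynomial representing [q]; when [P] projects onto [Y] and [K] is infinite,
    the choice does not affect the value. *)
Definition proj_valuation P xi q : Rinf R :=
  exist _ (gauss v (weights xi) (lin_subst P (repr q)))
    (mem_set (gauss_neqNy v (weights_neqNy xi) _)).

Lemma proj_valuation_restriction P xi f : projects_onto Y P ->
  val (proj_valuation P xi (restriction Y f)) =
  gauss v (weights xi) (lin_subst P f).
Proof.
move=> PY; congr gauss; apply: (lin_subst_restriction_eq Kinf PY).
by rewrite /restriction reprK.
Qed.

Lemma restriction_repr q : q = restriction Y (repr q).
Proof. by rewrite /restriction reprK. Qed.

Lemma proj_valuation_Yan P xi :
  projects_onto Y P -> Yan Y v (proj_valuation P xi).
Proof.
move=> PY; split=> [|c]; last first.
  apply: val_inj; rewrite -[coord_const _ _]/(restriction Y _).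
  rewrite proj_valuation_restriction// /lin_subst comp_mpolyC gaussC//.
  exact: weights_neqNy.
split=> q1 q2; rewrite [q1]restriction_repr [q2]restriction_repr.
- rewrite /restriction -rmorphM -!/(restriction Y _).
  rewrite !proj_valuation_restriction// /lin_subst.
  by rewrite comp_mpoly_is_multiplicative gaussM//; exact: weights_neqNy.
- rewrite /restriction -rmorphD -!/(restriction Y _).
  rewrite !proj_valuation_restriction// /lin_subst.
  by rewrite comp_mpolyD gaussD//; exact: weights_neqNy.
Qed.

(** On a single term, [w] equals the valuation of the coefficient plus the weight of the monomial;
    the ultrametric inequality handles their sum. *)
Lemma gauss_le_Yan (w : {ptws coordinate_ring Y -> Rinf R}) f : Yan Y v w ->
  (gauss v (weights (trop_map w)) f <= val (w (restriction Y f)))%E.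
Proof.
move=> [w_val wv].
have wC c : w (restriction Y (mpolyC n c)) = v c by exact: wv.
have w0 : val (w 0) = +oo%E.
  by rewrite -(field_valuation0 v_val) -wC mpolyC0 /restriction rmorph0.
have w1 : val (w 1) = 0%E.
  by rewrite -(field_valuation1 v_val) -wC mpolyC1 /restriction rmorph1.
rewrite {2}(mpolyE f) /restriction rmorph_sum/= -[leRHS]adde0.
apply: (le_valuation_sum w_val w0) => // m _.
rewrite adde0 -mul_mpolyC rmorphM (valuationM w_val) -!/(restriction Y _) wC.
rewrite mpolyXE_id /restriction rmorph_prod (valuation_prod w_val w1).
apply: le_trans (gauss_le v_val (weights_neqNy _) f m) _.
rewrite /term_val leeD2l// /mweight le_eqVlt; apply/orP; left; apply/eqP.
by apply: eq_bigr => i _; rewrite rmorphXn (valuationX w_val w1).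
Qed.

(** Apply the previous bound to the pulled-back polynomial, which has the same restriction to
    [Y]. *)
Lemma proj_valuation_le_Yan P (w : {ptws coordinate_ring Y -> Rinf R}) q :
  projects_onto Y P -> Yan Y v w ->
  (val (proj_valuation P (trop_map w) q) <= val (w q))%E.
Proof.
move=> PY wY; rewrite [in leRHS](restriction_repr q).
by rewrite -(restriction_lin_subst _ PY); exact: gauss_le_Yan.
Qed.

(** One inequality compares with a valuation [w] over [xi]; the other is adaptedness. *)
Lemma trop_proj_valuation P xi : projects_onto Y P -> Trop Y v xi ->
  adapted v (weights xi) P -> trop_map (proj_valuation P xi) = xi.
Proof.
move=> PY [w wY <-] /forallP ad; apply/funext => j; apply: val_inj.
apply/eqP; rewrite eq_le proj_valuation_le_Yan//=.
rewrite -[leRHS]/(val (proj_valuation _ _ (restriction Y _))).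
rewrite proj_valuation_restriction// lin_substX.
apply: gauss_linear_ge => //; first exact: weights_neqNy.
by move=> i; have /forallP := ad j; exact.
Qed.

Lemma continuous_proj_valuation P q : continuous (fun xi : Trop Y v =>
  val (proj_valuation P (val xi) q)).
Proof.
apply: continuous_gauss => //; first by move=> x i; exact: weights_neqNy.
move=> i x; apply: (@continuous_comp _ _ _ (fun xi : Trop Y v => val xi i) val).
  apply: (@continuous_comp _ _ _ (set_val : Trop Y v -> _)
    (fun f : {ptws _ -> _} => f i)).
    exact: initial_continuous.
  exact: (@proj_continuous _ (fun _ => _) i).
exact: initial_continuous.
Qed.

End TropicalLift.

(** * The continuous section *)

Unset Implicit Arguments.

Theorem theorem2p1 (R : realType) (K : fieldType) (v : K -> Rinf R)
    (v_val : is_field_valuation v) (v_surj : forall r, exists a, v a = r)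
    (n : nat) (Y : {vspace 'rV[K]_n}) :
  exists sigma : Trop Y v -> Yan Y v,
    continuous sigma /\ forall xi, trop (sigma xi) = xi.
Proof.
(* By surjectivity of [v] there are elements of valuation 0, 1, 2, and so on. *)
have Kinf : exists a : nat -> K, injective a.
  have /choice[a aE] : forall k : nat, exists c, val (v c) = k%:R%:E.
    move=> k; have k_fin : k%:R%:E \in Rinf R by rewrite inE.
    have [c cE] := v_surj (exist (fun x => x \in Rinf R) _ k_fin).
    by exists c; rewrite cE.
  exists a => k l /(congr1 (fun c => val (v c))); rewrite !aE => -[].
  by move/eqP; rewrite eqr_nat => /eqP.
have [s [sY s_ad]] := finite_adapted_projections v_val Y.
(* This pointwise choice carries no continuity in [xi]; that comes from the maximum below. *)
have /choice[P PP] : forall xi : Trop Y v, exists P, P \in s /\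
    adapted v (fun i => val (val xi i)) P.
  move=> xi; have [|P] := s_ad (fun i => val (val xi i)); last by exists P.
  by move=> i; exact: Rinf_neqNy.
have PY xi : projects_onto Y (P xi) by apply: sY; case: (PP xi).
have tropP xi : trop_map (proj_valuation v (Y := Y) (P xi) (val xi)) = val xi.
  by apply: trop_proj_valuation => //; [exact: set_valP|case: (PP xi)].
exists (fun xi => exist _ (proj_valuation v (P xi) (val xi))
  (mem_set (proj_valuation_Yan v_val Kinf (val xi) (PY xi)))).
split=> [|xi]; last by apply: val_inj; exact: tropP.
apply: continuous_comp_initial; apply: continuous_ptws => q.
apply: continuous_comp_initial.
(* The section takes, at each point, the largest of finitely many continuous
   lifts: no lift exceeds any valuation in the fibre, and one of them lies in
   it. *)
rewrite (_ : _ \o _ = fun xi : Trop Y v => \big[Order.max/-oo%E]_(Q <- s)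
    val (proj_valuation v Q (val xi) q)).
  by apply: continuous_bigmax => Q; exact: continuous_proj_valuation.
apply/funext => xi /=; apply/eqP; rewrite eq_le; apply/andP; split.
  apply: (le_bigmax_seq _ (P xi) predT
    (fun Q => val (proj_valuation v Q (val xi) q))) => //.
  by case: (PP xi).
rewrite big_seq; apply: bigmax_le => [|Q Qs]; first exact: leNye.
rewrite -[in leLHS](tropP xi); apply: proj_valuation_le_Yan => //;
  first exact: sY.
exact: proj_valuation_Yan.
Qed.
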